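(* Suppose that there exists a non-torsion topological Abelian group $H$ without non-trivial convergent sequences such that $H^m$ is countably compact for each $m<\omega$. Then there exists a topological free Abelian group $G$ of cardinality $\mathfrak c$ such that $G^m$ is countably compact for each $m<\omega$ and $G^\omega$ is not countably compact.
   Context: All topological groups are Hausdorff, and powers carry the product topology. A group is non-torsion if it has an element of infinite order. A topological free Abelian group is a free Abelian group (as an abstract group) endowed with a group topology. A space is countably compact if every sequence in it has an accumulation point, where $x$ is an accumulation point of $(x_n)_{n\in\omega}$ if every neighbourhood of $x$ contains $x_n$ for infinitely many $n$. A non-trivial convergent sequence is a convergent sequence that is not eventually constant. $\mathfrak c=2^{\aleph_0}$. *)

(* Defs.v *)
From mathcomp Require Import all_boot all_algebra.
From mathcomp Require Import all_classical topology tvs.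
From mathcomp.multinomials Require Import freeg.

Set Implicit Arguments.
Unset Strict Implicit.
Unset Printing Implicit Defensive.

Import GRing.Theory.

Local Open Scope classical_set_scope.
Local Open Scope card_scope.
Local Open Scope ring_scope.

Definition accumulation_point (T : topologicalType) (u : nat -> T) (x : T) :=
  forall U : set T, nbhs x U -> infinite_set [set n | U (u n)].

Definition countably_compact (T : topologicalType) :=
  forall u : nat -> T, exists x : T, accumulation_point u x.

Definition eventually_constant (T : Type) (u : nat -> T) :=
  exists c : T, \forall n \near \oo, u n = c.

Definition nontrivial_convergent (T : topologicalType) (u : nat -> T) :=
  (exists l : T, u @ \oo --> l) /\ ~ eventually_constant u.

Definition non_torsion (G : zmodType) :=
  exists x : G, forall n : nat, (0 < n)%N -> x *+ n != 0.

(* [{freeg K}] is the group of finitely supported integer combinations of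
   elements of [K]; freeness constrains the abstract group only. *)
Definition free_abelian (G : zmodType) :=
  exists (K : choiceType) (f : {additive {freeg K} -> G}), bijective f.

Definition has_card_continuum (T : Type) := [set: T] #= [set: nat -> bool].

(* Main.v *)
Require Import Defs.
From HB Require Import structures.
From mathcomp Require Import all_boot all_algebra.
From mathcomp Require Import all_classical topology tvs.
From mathcomp Require Import wochoice.
From mathcomp Require Import zify.
From mathcomp.multinomials Require Import freeg.

(** The group [G] is generated inside [H] by a basis chosen in transfinite
    recursion along a well-order of [nat -> bool] whose proper initial segments
    are small. Stage [t] is assigned a sequence of [m]-tuples in the subgroup [D]
    generated before it, and adjoins to [D] finitely many elements, free over [D],
    so that the enlarged group contains an accumulation point of the sequence.
    Such elements exist: Euclid's algorithm removes all relations
    [sum_i k_i f_i = const] holding on infinite sets, after which every nonzero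
    combination [sum_i k_i f_i] is finite-to-one. As [H] has no nontrivial
    convergent sequences, a binary tree of subsequences then yields accumulation
    points [y_b], [b : nat -> bool], for which [b |-> sum_i k_i y_b,i] is injective
    for every [k <> 0]. As [D] is small, some [y_b] is free over [D].

    An accumulation point in [G^omega] of a suitable sequence of partial sums
    satisfies [y_j = a + (j + 2) y_(j+1)] for all [j], which is impossible when [a]
    is a basis element. *)

Set Implicit Arguments.
Unset Strict Implicit.
Unset Printing Implicit Defensive.

Import GRing.Theory.

(** * Unbounded sets of indices and subsequences *)

Section Frequently.
Local Open Scope nat_scope.

Definition frequently (P : nat -> Prop) := forall N, exists n, N <= n /\ P n.

Lemma frequently_sub (P Q : nat -> Prop) :
  (forall n, P n -> Q n) -> frequently P -> frequently Q.
Proof. by move=> PQ fP N; have [n [Nn /PQ Qn]] := fP N; exists n. Qed.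

Lemma frequently_ge (P : nat -> Prop) N :
  frequently P -> frequently (fun n => N <= n /\ P n).
Proof.
move=> fP M; have [n [le_n Pn]] := fP (maxn M N); exists n.
by move: le_n; rewrite geq_max => /andP[].
Qed.

Lemma infinite_frequently (A : set nat) : infinite_set A <-> frequently A.
Proof.
split=> [infA N|fA finA].
  apply: contrapT => noA; apply: infA.
  apply: (@sub_finite_set _ _ `I_N); last exact: finite_II.
  move=> n An /=; rewrite ltnNge; apply/negP => Nn; apply: noA.
  by exists n.
have [s As] := (finite_seqP A).1 finA.
have [n [ltn]] := fA (\max_(i <- s) i).+1.
rewrite As => /= ns; have := @leq_bigmax_seq _ s xpredT id n ns isT.
by rewrite leqNgt ltn.
Qed.

Lemma increasing_ge (e : nat -> nat) : (forall n, e n < e n.+1) ->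
  forall n, n <= e n.
Proof. by move=> inc; elim=> // n IH; apply: leq_ltn_trans (inc n). Qed.

(** Each index is picked beyond the previous one. A constant [S] gives a subsequence inside [S], a
    decreasing [S] one that is eventually inside every [S n]. *)
Lemma frequently_thread (S : nat -> nat -> Prop) :
  (forall n, frequently (S n)) ->
  exists e : nat -> nat, (forall n, e n < e n.+1) /\ forall n, S n (e n).
Proof.
move=> fS; have [g gP] := choice (fun p : nat * nat => fS p.1 p.2).
pose e := fix e n := if n is k.+1 then g (k.+1, (e k).+1) else g (0, 0).
exists e; split=> [n|[|n]] /=; first by case: (gP (n.+1, (e n).+1)).
  by case: (gP (0, 0)).
by case: (gP (n.+1, (e n).+1)).
Qed.

Lemma frequently_comp (e : nat -> nat) (P : nat -> Prop) :
  (forall n, e n < e n.+1) -> frequently (fun n => P (e n)) -> frequently P.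
Proof.
move=> inc fP N; have [n [Nn Pn]] := fP N; exists (e n); split => //.
exact: leq_trans Nn (increasing_ge inc n).
Qed.

End Frequently.

(** * Neighbourhoods of zero in a topological group *)

Section NbhsZero.
Local Open Scope classical_set_scope.
Local Open Scope ring_scope.
Variable H : topologicalZmodType.
Implicit Types (U V : set H) (x y : H).

Lemma nbhs0_translate x (A : set H) :
  nbhs x A <-> nbhs (0 : H) [set h | A (h + x)].
Proof.
have shift (a b : H) B : nbhs (b + a) B -> nbhs b [set h | B (h + a)].
  move=> nB; pose F (h : H) := h + a.
  suff : {for b, continuous F} by move/(_ B nB).
  apply: (@continuous_comp _ _ _ (fun h : H => (h, a)) (fun p : H * H => p.1 + p.2)).
    by apply: cvg_pair => /=; [exact: cvg_id|exact: cvg_cst].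
  exact: add_continuous.
split=> [nA|nA]; first by apply: shift; rewrite add0r.
have := shift (- x) x [set h | A (h + x)].
rewrite subrr => /(_ nA); apply: filterS => h /=.
by rewrite addrNK.
Qed.

Lemma nbhs0_sub U : nbhs (0 : H) U ->
  exists2 V, nbhs (0 : H) V & forall a b, V a -> V b -> U (a - b).
Proof.
move=> nU; have := @sub_continuous H (0, 0) U; rewrite /= subr0.
move=> /(_ nU) [[A B] /= [nA nB] sub].
exists (A `&` B); first exact: filterI.
by move=> a b [Aa _] [_ Bb]; apply: (sub (a, b)).
Qed.

Lemma nbhs0_opp U : nbhs (0 : H) U -> nbhs (0 : H) [set h | U (- h)].
Proof.
move=> nU; have [V nV sub] := nbhs0_sub nU.
apply: filterS (nV) => h Vh /=; rewrite -sub0r; apply: sub => //.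
exact: nbhs_singleton nV.
Qed.

Lemma nbhs0_add U : nbhs (0 : H) U ->
  exists2 V, nbhs (0 : H) V & forall a b, V a -> V b -> U (a + b).
Proof.
move=> nU; have [V nV sub] := nbhs0_sub nU.
exists (V `&` [set h | V (- h)]); first by apply: filterI => //; exact: nbhs0_opp.
by move=> a b [Va _] [_ Vb]; rewrite -[b]opprK; apply: sub.
Qed.

Lemma nbhs0_mulrz U (k : int) : nbhs (0 : H) U ->
  exists2 V, nbhs (0 : H) V & forall a, V a -> U (a *~ k).
Proof.
move=> nU.
have pos (W : set H) n : nbhs (0 : H) W ->
    exists2 V, nbhs (0 : H) V & forall a, V a -> W (a *+ n).
  move=> nW; elim: n W nW => [|n IH] W nW.
    by exists W => // a _; rewrite mulr0n; exact: nbhs_singleton.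
  have [V nV add] := nbhs0_add nW; have [V' nV' mul] := IH V nV.
  exists (V `&` V'); first exact: filterI.
  by move=> a [Va V'a]; rewrite mulrS; apply: add => //; exact: mul.
case: k => n; first exact: pos.
have [V nV mul] := pos _ n.+1 (nbhs0_opp nU).
by exists V => // a /mul; rewrite NegzE mulrNz.
Qed.

Lemma nbhs0_lincomb m (k : 'I_m -> int) U : nbhs (0 : H) U ->
  exists2 V, nbhs (0 : H) V &
    forall a : 'I_m -> H, (forall i, V (a i)) -> U (\sum_i a i *~ k i).
Proof.
have gen (r : seq 'I_m) (W : set H) : nbhs (0 : H) W -> exists2 V, nbhs (0 : H) V &
    forall a : 'I_m -> H, (forall i, V (a i)) -> W (\sum_(i <- r) a i *~ k i).
  elim: r W => [|i r IH] W nW.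
    by exists W => // a _; rewrite big_nil; exact: nbhs_singleton.
  have [V nV add] := nbhs0_add nW; have [V' nV' sum] := IH V nV.
  have [V'' nV'' mul] := nbhs0_mulrz (k i) nV.
  exists (V' `&` V''); first exact: filterI.
  move=> a Va; rewrite big_cons; apply: add; first by apply: mul; case: (Va i).
  by apply: sum => j; case: (Va j).
exact: gen.
Qed.

Lemma hausdorff_nbhs0 : hausdorff_space H ->
  forall z, (forall U, nbhs (0 : H) U -> U z) -> z = 0.
Proof.
move=> hH z Uz; apply/esym/hH => A B nA nB; exists z; split; first exact: Uz.
exact: nbhs_singleton.
Qed.

End NbhsZero.

(** * Accumulation points in finite powers *)

Section Accumulation.
Local Open Scope classical_set_scope.
Local Open Scope ring_scope.
Variable H : topologicalZmodType.

(** One [U] serves all coordinates: as there are finitely many, such boxes form a base at [y] in the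
    product topology. *)
Definition acc m (f : nat -> 'I_m -> H) (y : 'I_m -> H) :=
  forall U : set H, nbhs (0 : H) U ->
    frequently (fun n => forall i, U (f n i - y i)).

Definition acc1 (u : nat -> H) (x : H) :=
  forall U : set H, nbhs (0 : H) U -> frequently (fun n => U (u n - x)).

Lemma nbhs_ptws_proj (I : eqType) (y : {ptws I -> H}) i (A : set H) :
  nbhs (y i) A -> nbhs y [set g : I -> H | A (g i)].
Proof. exact: (@proj_continuous I (fun=> H) i y A). Qed.

Lemma cvg_ptws (I : Type) (F : set_system (I -> H)) (y : {ptws I -> H}) :
  Filter F -> (forall i A, nbhs (y i) A -> F [set g | A (g i)]) -> F --> y.
Proof.
move=> FF Fy; rewrite cvg_sup => i A.
move=> [_ [[B Bop <-] By] subA].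
apply: filterS subA _; apply: Fy; exact: open_nbhs_nbhs.
Qed.

Lemma accumulation_acc m (f : nat -> {ptws 'I_m -> H}) (y : {ptws 'I_m -> H}) :
  accumulation_point f y <-> acc f y.
Proof.
split=> [accf U nU|accf W nW].
  apply/infinite_frequently.
  apply: (accf [set g | forall i, U (g i - y i)]).
  apply: (@filter_forall _ _ _ (nbhs y) _) => i.
  apply: (@nbhs_ptws_proj _ y i [set h | U (h - y i)]).
  apply/nbhs0_translate; apply: filterS nU => h /=.
  by rewrite addrK.
apply/infinite_frequently.
(* The boxes generate a filter converging to [y], so one of them lies inside [W]. *)
pose F : set_system ('I_m -> H) := filter_from (nbhs (0 : H))
  (fun U => [set g | forall i, U (g i - y i)]).
have FF : Filter F.
  apply: filter_from_filter; first by exists setT; exact: filterT.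
  move=> U V nU nV; exists (U `&` V); first exact: filterI.
  by move=> g gUV; split=> i; case: (gUV i).
have /(_ _ nW) [U nU sub] : F --> y.
  apply: cvg_ptws => i A /nbhs0_translate nA.
  by exists [set h | A (h + y i)] => // g /(_ i) /=; rewrite subrK.
by apply: frequently_sub (accf U nU) => n Un; exact: sub.
Qed.

Lemma acc_lincomb m (f : nat -> 'I_m -> H) y (k : 'I_m -> int) : acc f y ->
  acc1 (fun n => \sum_i f n i *~ k i) (\sum_i y i *~ k i).
Proof.
move=> accf U /(nbhs0_lincomb k) [V nV sub].
apply: frequently_sub (accf V nV) => n /sub.
by rewrite -sumrB; congr U; apply: eq_bigr => i _; rewrite mulrzBl.
Qed.

End Accumulation.

(** * Separating subsequences *)

Section Separation.
Local Open Scope classical_set_scope.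
Local Open Scope ring_scope.
Variable H : topologicalZmodType.
Hypothesis hausH : hausdorff_space H.
Hypothesis noconvH : ~ (exists u : nat -> H, nontrivial_convergent u).
Hypothesis ccH : forall m (f : nat -> 'I_m -> H), exists y, acc f y.

Definition acc_on (u : nat -> H) (S : nat -> Prop) (x : H) :=
  forall U : set H, nbhs (0 : H) U -> frequently (fun n => S n /\ U (u n - x)).

Definition finite_to_one (u : nat -> H) :=
  forall c, ~ frequently (fun n => u n = c).

Definition separated (u : nat -> H) (S T : nat -> Prop) :=
  forall x, acc_on u S x -> acc_on u T x -> False.

Lemma acc_on_sub u (S T : nat -> Prop) x :
  (forall n, S n -> T n) -> acc_on u S x -> acc_on u T x.
Proof.
move=> ST accS U nU; apply: frequently_sub (accS U nU) => n [Sn Un].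
by split=> //; exact: ST.
Qed.

Lemma separated_sub u (S S' T T' : nat -> Prop) :
  (forall n, S' n -> S n) -> (forall n, T' n -> T n) ->
  separated u S T -> separated u S' T'.
Proof.
move=> sS sT sep x accS accT.
by apply: (sep x); [exact: acc_on_sub accS|exact: acc_on_sub accT].
Qed.

Lemma acc_on_exists u (S : nat -> Prop) : frequently S -> exists x, acc_on u S x.
Proof.
move=> fS; have [e [inc Se]] := frequently_thread (fun=> fS).
have [y accy] := ccH (fun n (_ : 'I_1) => u (e n)).
exists (y ord0) => U nU.
apply: (frequently_comp inc); apply: frequently_sub (accy U nU) => n /(_ ord0).
by split.
Qed.

(** If [y] were the only accumulation point along [S], then [u] would converge to [y] along [S],
    since infinitely many indices outside a neighbourhood of [y] would have an accumulation point of
    their own. As [u] is finite-to-one, this convergence would be non-trivial. *)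
Lemma acc_on_neq u (S T : nat -> Prop) : finite_to_one u ->
  frequently S -> frequently T ->
  exists x y, [/\ acc_on u S x, acc_on u T y & x <> y].
Proof.
move=> fin_u fS fT; have [y accy] := acc_on_exists u fT.
apply: contrapT => noxy.
have uniq_acc x : acc_on u S x -> x = y.
  by move=> accx; apply: contrapT => xy; apply: noxy; exists x, y.
have [e [inc Se]] := frequently_thread (fun=> fS).
apply: noconvH; exists (u \o e); split.
  exists y => A nA; apply: contrapT => notA.
  have f2 : frequently (fun k => S k /\ ~ A (u k)).
    apply: (frequently_comp inc) => N; apply: contrapT => noN.
    apply: notA; exists N => // n /= Nn; apply: contrapT => An.
    by apply: noN; exists n; split.
  have [x accx] := acc_on_exists u f2.
  have xy : x = y by apply: uniq_acc; apply: acc_on_sub accx => n [].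
  have [n [_ [[_ nAn]]]] := accx _ ((nbhs0_translate y A).1 nA) 0%N.
  by rewrite xy /= subrK.
move=> [c [N _ cst]]; apply: (fin_u c).
apply: (frequently_comp inc) => M; exists (maxn M N); split.
  exact: leq_maxl.
by apply: cst => /=; exact: leq_maxr.
Qed.

(** [S] and [T] are cut down to the indices where [u] is [V]-close to two distinct accumulation
    points [x] and [y]. A common accumulation point [z] of the pieces would put [x - z] and [y - z]
    in [W], hence [x - y] in [U]. *)
Lemma separate u (S T : nat -> Prop) : finite_to_one u ->
  frequently S -> frequently T ->
  exists S' T', [/\ frequently S', frequently T', forall n, S' n -> S n,
    forall n, T' n -> T n & separated u S' T'].
Proof.
move=> fin_u fS fT; have [x [y [accx accy xy]]] := acc_on_neq fin_u fS fT.
have [U nU Uxy] : exists2 U, nbhs (0 : H) U & ~ U (x - y).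
  apply: contrapT => noU; apply: xy; apply/eqP; rewrite -subr_eq0; apply/eqP.
  apply: (hausdorff_nbhs0 hausH) => U nU; apply: contrapT => nUxy.
  by apply: noU; exists U.
have [W nW subW] := nbhs0_sub nU; have [V nV subV] := nbhs0_sub nW.
exists (fun n => S n /\ V (u n - x)), (fun n => T n /\ V (u n - y)).
split; [exact: accx|exact: accy|by move=> n []|by move=> n []|].
move=> z accSz accTz; apply: Uxy.
have close w R : acc_on u (fun n => R n /\ V (u n - w)) z -> W (w - z).
  move=> /(_ V nV 0%N) [n [_ [[_ Vw] Vz]]].
  by have := subV _ _ Vz Vw; rewrite opprB addrC addrA addrNK.
by have := subW _ _ (close _ _ accSz) (close _ _ accTz);
  rewrite opprB addrA addrNK.
Qed.

Variable u : nat -> nat -> H.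
Hypothesis fin_u : forall k, finite_to_one (u k).

(** The finitely many requests in [L] are met one after another; later shrinking preserves the
    separations already achieved. *)
Lemma refine (J : eqType) (L : seq (J * J * nat)) (A : J -> nat -> Prop) :
  (forall j, frequently (A j)) ->
  exists A' : J -> nat -> Prop, [/\ forall j, frequently (A' j),
    forall j n, A' j n -> A j n &
    forall i j k, (i, j, k) \in L -> i != j -> separated (u k) (A' i) (A' j)].
Proof.
elim: L A => [|[[i j] k] L IH] A fA; first by exists A.
have [ij|ij] := eqVneq i j.
  have [A' [fA' subA sepA]] := IH A fA; exists A'; split=> // i' j' k'.
  rewrite inE => /orP[/eqP[-> -> _]|]; last exact: sepA.
  by rewrite ij eqxx.
have [S' [T' [fS fT subS subT sep]]] := separate (@fin_u k) (fA i) (fA j).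
pose A1 l := if l == i then S' else if l == j then T' else A l.
have fA1 l : frequently (A1 l) by rewrite /A1; case: ifP => // _; case: ifP.
have subA1 l n : A1 l n -> A l n.
  rewrite /A1; case: eqP => [->|_]; first exact: subS.
  by case: eqP => [->|_]; first exact: subT.
have [A' [fA' subA sepA]] := IH A1 fA1; exists A'; split=> //.
  by move=> l n /subA /subA1.
move=> i' j' k'; rewrite inE => /orP[/eqP[-> -> ->] _|]; last exact: sepA.
apply: separated_sub sep => n /subA; first by rewrite /A1 eqxx.
by rewrite /A1 eq_sym (negbTE ij) eqxx.
Qed.

(** The newest bit is the head, so [b :: s] is a child of [s]. Level [n] handles only the first [n]
    sequences, so each level makes finitely many requests. *)
Lemma separation_tree :
  exists A : seq bool -> nat -> Prop, [/\ forall s, frequently (A s),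
    forall b s n, A (b :: s) n -> A s n &
    forall s t k, size s = size t -> s != t -> (k < size s)%N ->
      separated (u k) (A s) (A t)].
Proof.
pose L n := [seq (val p.1, val p.2, val k) |
  p <- enum {: n.-tuple bool * n.-tuple bool}, k <- enum 'I_n].
have inL n s t k : size s = n -> size t = n -> (k < n)%N -> (s, t, k) \in L n.
  move=> /eqP sn /eqP tn kn; apply/allpairsP.
  exists ((Tuple sn, Tuple tn), Ordinal kn).
  by rewrite /= !mem_enum.
pose P (p : nat * (seq bool -> nat -> Prop)) (A' : seq bool -> nat -> Prop) :=
  (forall j, frequently (p.2 j)) -> [/\ forall j, frequently (A' j),
    forall j n, A' j n -> p.2 j n &
    forall i j k, (i, j, k) \in L p.1 -> i != j -> separated (u k) (A' i) (A' j)].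
have [g gP] : exists g, forall p, P p (g p).
  suff /choice[g gP] : forall p, exists A', P p A' by exists g.
  move=> [n A].
  have [fA|nfA] := pselect (forall j, frequently (A j)); last by exists A.
  by have [A' ?] := refine (L n) fA; exists A'.
(* Both children of a node start from its set. [B n] is defined on all words, but only those of
   length [n] matter. *)
pose B := fix B n := if n is k.+1 then g (k.+1, fun s => B k (behead s))
  else fun _ _ => True.
have fB n : forall s, frequently (B n s).
  elim: n => [|n IH] s /=; first by move=> N; exists N.
  by have [|fr _ _] := gP (n.+1, fun s => B n (behead s)); [move=> j; exact: IH|].
have BP n := gP (n.+1, fun s => B n (behead s)) (fun s => fB n (behead s)).
exists (fun s => B (size s) s); split=> // [b s n|s t k].
  by have [_ sub _] := BP (size s); move/sub.
case: s => [|b s]; first by [].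
move=> st neq ks; rewrite -st; have [_ _ sep] := BP (size s).
by apply: sep => //; apply: inL.
Qed.

End Separation.

(** * Continuum many accumulation points along the branches of the tree *)

Section Branches.
Local Open Scope classical_set_scope.
Local Open Scope ring_scope.
Variable H : topologicalZmodType.
Hypothesis hausH : hausdorff_space H.
Hypothesis noconvH : ~ (exists u : nat -> H, nontrivial_convergent u).
Hypothesis ccH : forall m (f : nat -> 'I_m -> H), exists y, acc f y.

Fixpoint rev_prefix (b : nat -> bool) n : seq bool :=
  if n is k.+1 then b k :: rev_prefix b k else [::].

Lemma size_rev_prefix b n : size (rev_prefix b n) = n.
Proof. by elim: n => //= n ->. Qed.

Lemma rev_prefix_inj b c n : rev_prefix b n = rev_prefix c n ->
  forall k, (k < n)%N -> b k = c k.
Proof.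
elim: n => //= n IH [bc /IH{}IH] k; rewrite ltnS leq_eqVlt => /orP[/eqP->//|].
exact: IH.
Qed.

(* Along each branch of the tree [f] has an accumulation point; two branches
   eventually pass through nodes separated for the combination [k]. *)
Lemma perfect_accumulation m (f : nat -> 'I_m.+1 -> H) :
  (forall k : 'I_m.+1 -> int, (exists i, k i != 0) ->
    finite_to_one (fun n => \sum_i f n i *~ k i)) ->
  exists y : (nat -> bool) -> 'I_m.+1 -> H, (forall b, acc f (y b)) /\
    forall k : 'I_m.+1 -> int, (exists i, k i != 0) ->
      injective (fun b => \sum_i y b i *~ k i).
Proof.
move=> fin_f.
pose lin (k : {ffun 'I_m.+1 -> int}) n := \sum_i f n i *~ k i.
(* [dec] enumerates the nonzero coefficient vectors. The zero vector and invalid codes become the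
   all-one vector, so that every [lin (dec j)] is finite-to-one. *)
pose dec j : {ffun 'I_m.+1 -> int} :=
  if (unpickle j : option {ffun 'I_m.+1 -> int}) is Some k
  then if k == [ffun=> 0] then [ffun=> 1] else k else [ffun=> 1].
have fin_u j : finite_to_one (lin (dec j)).
  apply: fin_f; have one : exists i, ([ffun=> 1] : {ffun 'I_m.+1 -> int}) i != 0.
    by exists ord0; rewrite ffunE.
  rewrite /dec; case: (unpickle j : option {ffun 'I_m.+1 -> int}) => // k.
  case: eqP => // k0; apply: contrapT => noi; apply: k0; apply/ffunP => i.
  rewrite ffunE; apply/eqP/negPn/negP => ki; apply: noi; by exists i.
have [A [fA subA sepA]] := separation_tree hausH noconvH ccH fin_u.
have subP b n n' : (n <= n')%N ->
    forall x, A (rev_prefix b n') x -> A (rev_prefix b n) x.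
  move=> /subnKC <-; elim: (n' - n)%N => [|d IH] x; first by rewrite addn0.
  by rewrite addnS /= => /subA /IH.
have exy b : exists y, acc f y /\ forall k n, acc_on (lin (dec k))
    (A (rev_prefix b n)) (\sum_i y i *~ dec k i).
  (* The diagonal subsequence is eventually inside every node of the branch, so a single [y] works
     for all its nodes. *)
  have [e [inc eA]] := frequently_thread (fun n => fA (rev_prefix b n)).
  have [y accy] := ccH (fun n => f (e n)); exists y; split=> [U nU|k N U nU].
    exact: (frequently_comp inc (accy U nU)).
  have := frequently_ge N (acc_lincomb (dec k) accy nU) => fr.
  apply: (frequently_comp inc); apply: frequently_sub fr => n [Nn Un].
  by split=> //; apply: (subP _ _ n).
have [y yP] := choice exy; exists y; split=> [b|k k0 b c /= ybc].
  by case: (yP b).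
apply: contrapT => bc; have [i bci] : exists i, b i != c i.
  apply: contrapT => noi; apply: bc; apply/funext => i.
  by apply/eqP/negPn/negP => bci; apply: noi; exists i.
pose k' : {ffun 'I_m.+1 -> int} := [ffun i => k i].
have kk' : dec (pickle k') = k'.
  rewrite /dec pickleK; case: eqP => // k'0; case: k0 => j.
  by have /ffunP/(_ j) := k'0; rewrite !ffunE => ->; rewrite eqxx.
(* Long enough for the two prefixes to differ at [i] and for the level to treat the combination
   [k']. *)
set N := (maxn i (pickle k')).+1.
have acck z : (forall k n, acc_on (lin (dec k)) (A (rev_prefix z n))
    (\sum_i y z i *~ dec k i)) ->
    acc_on (lin k') (A (rev_prefix z N)) (\sum_i y z i *~ k i).
  move=> /(_ (pickle k') N); rewrite kk'; congr acc_on; apply: eq_bigr => j _.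
  by rewrite ffunE.
have sep : separated (lin (dec (pickle k')))
    (A (rev_prefix b N)) (A (rev_prefix c N)).
  apply: sepA; rewrite ?size_rev_prefix ?ltnS ?leq_maxr //.
  apply/eqP => /rev_prefix_inj /(_ i); rewrite ltnS leq_maxl => /(_ isT) eqi.
  by rewrite eqi eqxx in bci.
rewrite kk' in sep; apply: sep (acck b _) _; first by case: (yP b).
by rewrite ybc; apply: acck; case: (yP c).
Qed.

End Branches.

(** * Free extensions by accumulation points *)

Section FreeExtension.
Local Open Scope classical_set_scope.
Local Open Scope ring_scope.
Variable H : topologicalZmodType.
Hypothesis hausH : hausdorff_space H.
Hypothesis noconvH : ~ (exists u : nat -> H, nontrivial_convergent u).
Hypothesis ccH : forall m (f : nat -> 'I_m -> H), exists y, acc f y.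

Variable D : set H.
Hypothesis D0 : D 0.
Hypothesis DB : forall a b, D a -> D b -> D (a - b).
Hypothesis Dtf : forall a (k : int), D a -> k != 0 -> a *~ k = 0 -> a = 0.
(** The factor [nat] leaves room for the code of a coefficient vector. *)
Hypothesis Dsmall : forall (g : (nat -> bool) -> nat) (h : (nat -> bool) -> H),
  (forall b, D (h b)) -> ~ injective (fun b => (g b, h b)).

(** Independence of the classes of the [x i] in the quotient of [H] by [D]. *)
Definition free_over m (x : 'I_m -> H) :=
  forall k : 'I_m -> int, D (\sum_i x i *~ k i) -> forall i, k i = 0.

Definition adjoin m (x : 'I_m -> H) (h : H) :=
  exists k : 'I_m -> int, D (h - \sum_i x i *~ k i).

Definition acc_free_extension m (f : nat -> 'I_m -> H) :=
  exists s (x : 'I_s -> H) (y : 'I_m -> H),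
    [/\ free_over x, forall i, adjoin x (y i) & acc f y].

Lemma subgroup_subMz a b (e : int) : D a -> D b -> D (a - b *~ e).
Proof.
move=> Da Db; apply: DB => //.
have DN c : D c -> D (- c) by move=> Dc; rewrite -sub0r; apply: DB.
have Dn n : D (b *+ n).
  elim: n => [|n IH]; rewrite ?mulr0n // mulrS -[_ *+ n]opprK.
  by apply: DB => //; exact: DN.
by case: e => n; rewrite ?NegzE ?mulrNz; [|apply: DN]; exact: Dn.
Qed.

Lemma adjoin_subMz m (x : 'I_m -> H) a b (e : int) :
  adjoin x a -> adjoin x b -> adjoin x (a - b *~ e).
Proof.
move=> [k Dk] [l Dl]; exists (fun i => k i - l i * e).
have := subgroup_subMz e Dk Dl; congr D.
under [in RHS]eq_bigr => i _ do rewrite mulrzBr mulrzA.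
rewrite sumrB -mulrz_suml mulrzBl !opprB addrACA [RHS]addrACA.
by congr (_ + _); rewrite addrC.
Qed.

Section Relation.
Variable m : nat.
Hypothesis IHm : forall f : nat -> 'I_m -> H,
  (forall n i, D (f n i)) -> acc_free_extension f.

(** The coordinate [i] is dropped, the induction hypothesis is applied along a subsequence inside
    [S], and [c], an element of [D], is put back. *)
Lemma constant_coordinate (f : nat -> 'I_m.+1 -> H) (S : nat -> Prop) i c :
  (forall n j, D (f n j)) -> frequently S -> (forall n, S n -> f n i = c) ->
  acc_free_extension f.
Proof.
move=> Df fS cst; have [e [inc Se]] := frequently_thread (fun=> fS).
have Dc : D c by rewrite -(cst _ (Se 0%N)).
have [s [x [y [frx adx accy]]]] := IHm (f := fun n l => f (e n) (fintype.lift i l))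
  (fun n l => Df _ _).
exists s, x, (fun l => if unlift i l is Some l' then y l' else c); split=> //.
  move=> l; case: unliftP => [l' _|_] //.
  by exists (fun=> 0); under eq_bigr do rewrite mulr0z; rewrite big1_eq subr0.
move=> U nU; apply: (frequently_comp inc).
apply: frequently_sub (accy U nU) => n Un l.
case: unliftP => [l' ->|->] //.
by rewrite (cst _ (Se n)) subrr; exact: nbhs_singleton.
Qed.

(** A single subtraction or addition suffices, according to the signs. *)
Lemma euclid_step (a b : int) : a != 0 -> b != 0 -> (`|b| <= `|a|)%N ->
  exists e : int, (absz (a - e * b)%R < absz a)%N.
Proof.
move=> a0 b0 le_ba.
have [s|s] := boolP ((0 < a) == (0 < b)); [exists 1|exists (-1)]; lia.
Qed.

(* Euclid's algorithm on the coefficients of a relation that holds on an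
   infinite set reduces it to [k_i f_i = c], and [f_i] is then constant there
   since [D] is torsion-free. *)
Lemma relation_extension N (k : 'I_m.+1 -> int) (f : nat -> 'I_m.+1 -> H)
    (S : nat -> Prop) c : (\sum_i `|k i| <= N)%N -> (exists i, k i != 0) ->
  (forall n j, D (f n j)) -> frequently S ->
  (forall n, S n -> \sum_i f n i *~ k i = c) -> acc_free_extension f.
Proof.
elim: N k f => [|N IH] k f.
  rewrite leqn0 sum_nat_eq0 => /forallP k0 [i].
  by have := k0 i; rewrite absz_eq0 => /eqP ->; rewrite eqxx.
move=> kN [i ki] Df fS cst.
have [two|one] := pselect (exists j, j != i /\ k j != 0); last first.
  have kj j : j != i -> k j = 0.
    by move=> ji; apply/eqP/negPn/negP => kj; apply: one; exists j.
  have cst' n : S n -> f n i *~ k i = c.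
    move=> /cst; rewrite (bigD1 i) //= big1 ?addr0 // => j ji.
    by rewrite kj // mulr0z.
  have [n0 [_ Sn0]] := fS 0%N.
  apply: (constant_coordinate (i := i) (c := f n0 i) Df fS) => n Sn.
  apply/eqP; rewrite -subr_eq0; apply/eqP.
  apply: (Dtf (k := k i)) => //; first exact: DB.
  by rewrite mulrzBl !cst' // subrr.
have [i0 [j [ji ki0 kj le_ji]]] : exists i j,
    [/\ j != i, k i != 0, k j != 0 & (`|k j| <= `|k i|)%N].
  case: two => j [ji kj]; have [le|/ltnW le] := leqP `|k j|%N `|k i|%N.
    by exists i, j.
  by exists j, i; rewrite eq_sym.
have [e lt_e] := euclid_step ki0 kj le_ji.
(* Lowering [k i0] by [e * k j] is offset by adding [e] times coordinate [i0] to coordinate [j]: the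
   value of the relation is unchanged while the sum of the absolute values drops. *)
pose k' l := if l == i0 then k i0 - e * k j else k l.
pose f' n l := if l == j then f n j + f n i0 *~ e else f n l.
have Df' n l : D (f' n l).
  rewrite /f'; case: eqP => // _.
  by have := subgroup_subMz (- e) (Df n j) (Df n i0); rewrite mulrNz opprK.
have cst' n : S n -> \sum_l f' n l *~ k' l = c.
  move=> /cst <-; rewrite (bigD1 i0) //= (bigD1 j) //=.
  rewrite [in RHS](bigD1 i0) //= [in RHS](bigD1 j) //=.
  rewrite /f' /k' !eqxx (negbTE ji) eq_sym (negbTE ji).
  rewrite mulrzBr mulrzDl -!addrA; congr (_ + _).
  rewrite addrCA mulrzA addKr; congr (_ + _).
  by apply: eq_bigr => l /andP[/negbTE -> /negbTE ->].
have k'N : (\sum_l `|k' l| <= N)%N.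
  rewrite -ltnS; apply: leq_trans kN.
  rewrite (bigD1 i0) //= [X in (_ < X)%N](bigD1 i0) //= /k' eqxx -addSn leq_add //.
  by apply: leq_sum => l /negbTE ->.
have k'0 : exists l, k' l != 0 by exists j; rewrite /k' (negbTE ji).
have [s [x [y [frx adx accy]]]] := IH k' f' k'N k'0 Df' fS cst'.
(* The change of coordinates is undone on the accumulation point. *)
exists s, x, (fun l => if l == j then y j - y i0 *~ e else y l); split=> //.
  by move=> l; case: eqP => // _; exact: adjoin_subMz.
move=> U nU; have [V nV subV] := nbhs0_sub nU.
have [W nW mulW] := nbhs0_mulrz e nV.
have nUVW : nbhs (0 : H) (U `&` (V `&` W)) by do 2?apply: filterI.
apply: frequently_sub (accy _ nUVW) => n Un l.
case: eqP => [->|/eqP lj]; last first.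
  by have [] := Un l; rewrite /f' (negbTE lj).
have [_ [Vj _]] := Un j; have [_ [_ /mulW Wi]] := Un i0.
have := subV _ _ Vj Wi; congr U.
rewrite /f' eqxx (eq_sym i0 j) (negbTE ji) mulrzBl !opprB.
rewrite (addrC (y i0 *~ e)) addrA (addrAC (f n j)) addrK addrAC addrA.
reflexivity.
Qed.

End Relation.

Lemma accumulation_free_extension m (f : nat -> 'I_m -> H) :
  (forall n i, D (f n i)) -> acc_free_extension f.
Proof.
elim: m f => [|m IH] f Df.
  exists 0%N, (fun=> 0), (fun=> 0).
  by split=> [k _ []||U nU N] //; [case|exists N; split=> // -[]].
have [[k [c [k0 fk]]]|norel] := pselect (exists k c,
    (exists i : 'I_m.+1, k i != 0) /\
    frequently (fun n => \sum_i f n i *~ k i = c)).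
  by apply: (relation_extension IH (leqnn _) k0 Df fk (c := c)).
have [|y [accy injy]] := perfect_accumulation hausH noconvH ccH (f := f).
  by move=> k k0 c fk; apply: norel; exists k, c.
(* Otherwise each [b] has a nonzero [k b] whose combination lies in [D]. The code of [k b] and that
   value together determine [b], against [Dsmall]. *)
have [b frb] : exists b, free_over (y b).
  apply: contrapT => nob.
  have [k kP] : exists k : (nat -> bool) -> {ffun 'I_m.+1 -> int}, forall b,
      (exists i, k b i != 0) /\ D (\sum_i y b i *~ k b i).
    suff /choice[k kP] : forall b, exists k : {ffun 'I_m.+1 -> int},
      (exists i, k i != 0) /\ D (\sum_i y b i *~ k i) by exists k.
    move=> b; apply: contrapT => nok; apply: nob; exists b => k Dk i.
    apply/eqP/negPn/negP => ki; apply: nok; exists [ffun i => k i]; split.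
      by exists i; rewrite ffunE.
    by move: Dk; congr D; apply: eq_bigr => j _; rewrite ffunE.
  apply: (Dsmall (g := fun b => pickle (k b))
    (h := fun b => \sum_i y b i *~ k b i)) => [b|b c /= [kbc ybc]].
    by case: (kP b).
  have {}kbc : k b = k c by apply: (pcan_inj pickleK).
  by move: ybc; rewrite kbc; apply: injy; case: (kP c).
exists m.+1, (y b), (y b); split=> // i; exists (fun j => (j == i)%:R).
rewrite (bigD1 i) //= eqxx big1 ?addr0 ?subrr // => j /negbTE ->.
exact: mulr0z.
Qed.

End FreeExtension.

(** * Sets smaller than the continuum *)

Section Continuum.
Local Open Scope nat_scope.
Notation T := (nat -> bool).

(** Cardinality at most that of the continuum. *)
Definition embeds (X : Type) := exists f : X -> T, injective f.

Lemma embeds_inj X Y (f : X -> Y) : injective f -> embeds Y -> embeds X.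
Proof. by move=> injf [g injg]; exists (g \o f); exact: inj_comp. Qed.

Lemma embeds_count (X : countType) : embeds X.
Proof.
exists (fun x n => n == pickle x) => x y /(congr1 (@^~ (pickle x))).
by rewrite eqxx => /esym/eqP/(pcan_inj pickleK).
Qed.

Lemma embeds_fun X : embeds X -> embeds (nat -> X).
Proof.
move=> [f injf].
exists (fun g n => if (unpickle n : option (nat * nat)) is Some p then f (g p.1) p.2
  else false).
move=> g h gh; apply/funext => i; apply: injf; apply/funext => j.
by have := congr1 (@^~ (pickle (i, j))) gh; rewrite /= pickleK.
Qed.

Lemma embeds_prod X Y : embeds X -> embeds Y -> embeds (X * Y).
Proof.
move=> [f injf] [g injg].
apply: (@embeds_inj _ (nat -> T) (fun p n => if n is 0 then f p.1 else g p.2)).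
  move=> [x y] [x' y'] /= e; congr pair.
    by apply: injf; have := congr1 (@^~ 0) e.
  by apply: injg; have := congr1 (@^~ 1) e.
by apply: embeds_fun; exists id.
Qed.

Lemma embeds_seq X : embeds X -> embeds (seq X).
Proof.
move=> [f injf].
apply: (@embeds_inj _ (nat * (nat -> T))
  (fun s => (size s, nth (fun=> true) (map f s)))).
  move=> s t [st nst]; apply: (inj_map injf).
  apply: (@eq_from_nth _ (fun=> true)); first by rewrite !size_map.
  by move=> i _; rewrite nst.
apply: embeds_prod; first exact: embeds_count.
by apply: embeds_fun; exists id.
Qed.

Notation word := (seq (nat + T)).

Definition word_over (A : T -> Prop) (w : word) := forall t, inr t \in w -> A t.

(* Counting words over [nat + A] instead of elements of [A] makes smallness
   stable under adding points and under forming words, without any recourse to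
   [|A * A| = |A|]. *)
Definition small (A : T -> Prop) :=
  ~ exists f : T -> word, injective f /\ forall t, word_over A (f t).

Lemma small_recode (A B : T -> Prop) (phi : word -> word) :
  (forall u v, word_over A u -> word_over A v -> phi u = phi v -> u = v) ->
  (forall w, word_over A w -> word_over B (phi w)) -> small B -> small A.
Proof.
move=> injphi AB sB [f [injf fA]]; apply: sB; exists (phi \o f); split.
  by move=> x y /injphi e; apply: injf; apply: e; exact: fA.
by move=> t; exact: AB.
Qed.

Lemma small_sub (A B : T -> Prop) : (forall t, A t -> B t) -> small B -> small A.
Proof.
move=> AB; apply: (@small_recode _ _ id) => // w Aw t /Aw; exact: AB.
Qed.

Lemma small_injection (A : T -> Prop) (f : T -> T) :
  injective f -> small A -> ~ forall t, A (f t).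
Proof.
move=> injf sA Af; apply: sA; exists (fun t => [:: inr (f t)]); split.
  by move=> x y [/injf].
by move=> t s; rewrite inE => /eqP[->].
Qed.

(** As in Hilbert's hotel, shifting the numerical letters frees [inl 0] to stand for [t0]. *)
Lemma small_add (A : T -> Prop) t0 : small A -> small (fun t => A t \/ t = t0).
Proof.
pose h (l : nat + T) : nat + T :=
  match l with inl n => inl n.+1 | inr t => if t == t0 then inl 0 else inr t end.
have injh : injective h.
  move=> [n|s] [m|t] //=.
  - by case=> ->.
  - by case: eqP.
  - by case: eqP.
  by case: eqP => [->|_]; case: eqP => [->|_] // [->].
apply: (@small_recode _ _ (map h)).
  by move=> u v _ _; exact: inj_map.
move=> w Aw t /mapP[[n|s] //= sw].
by case: eqP => // st [->]; have [|] := Aw _ sw.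
Qed.

(* Each block records its own length, so a concatenation of blocks is decodable. *)
Definition block (f : T -> word) (l : nat + T) : word :=
  match l with
  | inl n => [:: inl 0; inl n]
  | inr t => inl (size (f t)).+1 :: f t
  end.

(** The header [inl 0] announces a number and a positive header a spelled-out point, so decoding
    proceeds from the left. *)
Lemma flatten_block_inj f : injective f -> injective (flatten \o map (block f)).
Proof.
move=> injf; elim=> [|l u IH] [|l' v] //=.
- by case: l'.
- by case: l.
case: l l' => [n|s] [n'|t] //=.
  by case=> -> /IH ->.
case=> fst /eqP; rewrite eqseq_cat // => /andP[/eqP/injf -> /eqP/IH ->].
done.
Qed.

Lemma small_words (A B : T -> Prop) (f : T -> word) : injective f ->
  (forall t, A t -> word_over B (f t)) -> small B -> small A.
Proof.
move=> injf AB; apply: (@small_recode _ _ (flatten \o map (block f))).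
  by move=> u v _ _; exact: flatten_block_inj.
move=> w Aw t /flattenP[_ /mapP[[n|s] sw ->]]; rewrite !inE //= => tf.
exact: AB (Aw _ sw) _ tf.
Qed.

(** The counterpart of ordering the continuum by its initial ordinal, with [small] for smaller
    cardinality. *)
Definition short_wellorder (lt : T -> T -> Prop) :=
  [/\ well_founded lt, forall s t u, lt s t -> lt t u -> lt s u,
    forall s t, [\/ lt s t, s = t | lt t s] & forall t, small (lt^~ t)].

(** Starting from unique least elements of nonempty sets, the order axioms are recovered from sets
    of at most three points. *)
Lemma strict_wellorder : exists lt : T -> T -> Prop,
  [/\ well_founded lt, forall s t u, lt s t -> lt t u -> lt s u &
    forall s t, [\/ lt s t, s = t | lt t s]].
Proof.
have [R woR] := well_ordering_principle T.
have min_uniq (P : T -> Prop) : (exists x, P x) -> exists z,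
    [/\ P z, forall x, P x -> R z x &
      forall w, P w -> (forall x, P x -> R w x) -> z = w].
  move=> [x Px]; have [|z [[Pz minz] uniqz]] := woR [pred x | `[< P x >]].
    by exists x; apply/asboolP.
  exists z; split=> [|y Py|w Pw minw]; first exact/asboolP.
    by apply: minz; apply/asboolP.
  by apply: uniqz; split=> [|y /asboolP]; [exact/asboolP|exact: minw].
have minR (P : T -> Prop) : (exists x, P x) ->
    exists z, P z /\ forall x, P x -> R z x.
  by move=> /min_uniq[z [Pz minz _]]; exists z.
have reflR x : R x x.
  by have [|z [-> ]] := minR (eq x); [exists x|apply].
have antiR x y : R x y -> R y x -> x = y.
  move=> Rxy Ryx; have [|z [_ _ uniqz]] := min_uniq (fun z => z = x \/ z = y).
    by exists x; left.
  rewrite -(uniqz x); last 2 first.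
  - by left.
  - by move=> _ [->|->].
  by apply: uniqz; [right|move=> _ [->|->]].
exists (fun s t => R s t /\ s <> t); split.
- move=> x; apply: contrapT => nx.
  have [|z [nz min]] := minR (fun x => ~ Acc (fun s t => R s t /\ s <> t) x).
    by exists x.
  apply: nz; constructor => y [Ryz yz]; apply: contrapT => /min Rzy.
  by apply: yz; exact: antiR.
- move=> s t u [Rst st] [Rtu tu].
  have [|z [zP min]] := minR (fun x => [\/ x = s, x = t | x = u]).
    by exists s; constructor.
  have Rzs := min _ (Or31 _ _ erefl); have Rzt := min _ (Or32 _ _ erefl).
  have Rzu := min _ (Or33 _ _ erefl).
  case: zP => ez; rewrite {}ez in Rzs Rzt Rzu *.
  + by split=> // su; apply: st; apply: antiR => //; rewrite su.
  + by case: st; exact: antiR.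
  by case: tu; exact: antiR.
move=> s t; have [->|/eqP st] := eqVneq s t; first exact: Or32.
have [|z [[->|->] min]] := minR (fun x => x = s \/ x = t); first by exists s; left.
  by apply: Or31; split=> //; apply: min; right.
by apply: Or33; split=> [|ts]; [apply: min; left|apply: st].
Qed.

(** Cantor's diagonal argument: [d] would differ from itself at its own code. *)
Lemma no_countable_code (X : countType) (f : T -> X) : ~ injective f.
Proof.
move=> injf; pose d n := `[< forall t, pickle (f t) = n -> ~~ t n >].
have [dd|] := boolP (d (pickle (f d))).
  by have /asboolP/(_ d erefl)/negP := dd.
move=> /[dup] ndd /asboolPn; apply => t /(pcan_inj pickleK)/injf ->.
exact: ndd.
Qed.

Section Shorten.
Variable r : T -> T -> Prop.
Hypothesis wf_r : well_founded r.
Hypothesis trans_r : forall s t u, r s t -> r t u -> r s u.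
Hypothesis total_r : forall s t, [\/ r s t, s = t | r t s].

(** In the application, the first initial segment of [r] that is not small. *)
Variable K : T -> Prop.
Hypothesis smallK : forall t, K t -> small (r^~ t).
Hypothesis bigK : ~ small K.

(** [K] has no greatest element: otherwise it would be contained in a small initial segment plus one
    point, hence be small. *)
Lemma above_finite (w : word) : word_over K w ->
  exists2 t, K t & word_over (r^~ t) w.
Proof.
have above t : K t -> exists2 u, K u & r t u.
  move=> Kt; apply: contrapT => nou; apply: bigK.
  apply: small_sub (small_add (t0 := t) (smallK Kt)) => u Ku.
  have [ut|->|tu] := total_r u t; [by left|by right|].
  by case: nou; exists u.
elim: w => [|[n|s] w IH] Kw.
(* If [K] were empty, words over [K] would contain only numbers and would code [T] in a countable
   type. *)
- have [t Kt] : exists t, K t.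
    apply: contrapT => noK; apply: bigK => -[f [injf fK]].
    apply: (@no_countable_code (seq nat)
      (fun t => map (fun l => if l is inl n then n else 0) (f t))).
    move=> t s e; apply: injf; apply: (@eq_from_nth _ (inl 0)).
      by have := congr1 size e; rewrite !size_map.
    move=> i ilt; have := congr1 (nth 0 ^~ i) e.
    have ilt' : i < size (f s) by have := congr1 size e; rewrite !size_map => <-.
    rewrite !(nth_map (inl 0)) //.
    have := mem_nth (inl 0) ilt; have := mem_nth (inl 0) ilt'.
    case: (nth _ (f t) i) => [n|u]; case: (nth _ (f s) i) => [m|v].
    + by move=> _ _ ->.
    + by move=> /fK Kv; case: noK; exists v.
    + by move=> _ /fK Ku; case: noK; exists u.
    by move=> /fK Kv; case: noK; exists v.
  by exists t.
- have [|t Kt wt] := IH; first by move=> u uw; apply: Kw; rewrite inE uw orbT.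
  by exists t => // u; rewrite inE => /orP[/eqP //|]; exact: wt.
have [|t Kt wt] := IH; first by move=> u uw; apply: Kw; rewrite inE uw orbT.
have Ks : K s by apply: Kw; rewrite inE eqxx.
have [u Ku su] := above s Ks.
have [tu|tu|ut] := total_r t u.
- exists u => // v; rewrite inE => /orP[/eqP[->] //|/wt vt].
  exact: trans_r tu.
- by exists t => // v; rewrite inE => /orP[/eqP[->]|/wt //]; rewrite tu.
exists t => // v; rewrite inE => /orP[/eqP[->]|/wt //].
exact: trans_r ut.
Qed.

(* [T] is ranked by an upper bound [h x] in [K] of the letters of the word [f x];
   all points of rank at most [t] are coded by words over [r^~ t]. *)
Lemma shorten : exists lt, short_wellorder lt.
Proof.
have [f [injf fK]] := contrapT bigK.
have /choice[h hP] : forall x, exists t, K t /\ word_over (r^~ t) (f x).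
  by move=> x; have [t] := above_finite (fK x); exists t.
pose lt x y := r (h x) (h y) \/ h x = h y /\ r x y.
exists lt; split.
- have wf_lt t : forall x, h x = t -> Acc lt x.
    elim/(well_founded_ind wf_r): t => t IHt x.
    elim/(well_founded_ind wf_r): x => x IHx hx; constructor => y [].
      by rewrite hx => /IHt; apply.
    by rewrite hx => -[hy /IHx]; apply.
  by move=> x; exact: wf_lt.
- move=> s t u [st|[st rst]] [tu|[tu rtu]].
  + by left; exact: trans_r tu.
  + by left; rewrite -tu.
  + by left; rewrite st.
  by right; rewrite st; split=> //; exact: trans_r rtu.
- move=> s t; have [st|st|ts] := total_r (h s) (h t).
  + by apply: Or31; left.
  + have [rst|->|rts] := total_r s t.
    * by apply: Or31; right.
    * exact: Or32.
    by apply: Or33; right.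
  by apply: Or33; left.
move=> y; have [Ky _] := hP y; apply: (small_words injf) (smallK Ky) => x.
case=> [xy|[xy _]] t tx; last by rewrite -xy; have [_] := hP x; apply.
by apply: trans_r xy; have [_] := hP x; apply.
Qed.

End Shorten.

(** Either an arbitrary well-order is already short, or descent reaches the first initial segment
    that is not small, to which [shorten] applies. *)
Lemma continuum_wellorder : exists lt, short_wellorder lt.
Proof.
have [r [wf_r trans_r total_r]] := strict_wellorder.
have [sm|/existsNP[t]] := pselect (forall t, small (r^~ t)); first by exists r; split.
elim/(well_founded_ind wf_r): t => t IH bigt.
have [sm|] := pselect (forall s, r s t -> small (r^~ s)).
  exact: (shorten wf_r trans_r total_r sm bigt).
by move=> /existsNP[s] /not_implyP[rst]; exact: IH.
Qed.

Section ShortWellorder.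
Variable lt : T -> T -> Prop.
Hypothesis lt_short : short_wellorder lt.

Lemma small_le t : small (fun s => lt s t \/ s = t).
Proof. by case: lt_short => _ _ _ sm; exact: small_add. Qed.

Lemma not_lt_le s t : ~ lt t s -> lt s t \/ s = t.
Proof.
by case: lt_short => _ _ tot _ nts; have [|->|//] := tot s t; [left|right].
Qed.

Lemma unbounded_injection (f : T -> T) t : injective f -> exists s, lt t (f s).
Proof.
move=> injf; apply: contrapT => nos.
apply: (small_injection injf (@small_le t)) => s; apply: not_lt_le => lts.
by apply: nos; exists s.
Qed.

(* Koenig's theorem for a countable union of initial segments. *)
Lemma countable_bounded (u : nat -> T) : exists t, forall n, lt (u n) t.
Proof.
apply: contrapT => not_bd.
have [e inje] : embeds (nat -> T) by apply: embeds_fun; exists id.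
(* If no [x] worked at [n], each [x] would have some [g x] with value [x] at [n] and [e (g x)] not
   above [u n]. These images are distinct, so they cannot be bounded. *)
have /choice[c cP] : forall n, exists x, forall g, g n = x -> lt (u n) (e g).
  move=> n; apply: contrapT => nox.
  have /choice[g gP] : forall x, exists g : nat -> T, g n = x /\ ~ lt (u n) (e g).
    move=> x; apply: contrapT => nog; apply: nox; exists x => g gx.
    by apply: contrapT => nlt; apply: nog; exists g.
  have inj_eg : injective (e \o g).
    by move=> x y /inje gxy; case: (gP x) => <- _; rewrite gxy; case: (gP y).
  have [s] := unbounded_injection (u n) inj_eg.
  by case: (gP s).
by apply: not_bd; exists (e c) => n; exact: cP.
Qed.

(** The fibre over [x] contains the image of an injection of [T], which no initial segment can
    hold. *)
Lemma unbounded_enumeration X (x0 : X) : embeds X ->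
  exists d : T -> X, forall x t, exists2 s, lt t s & d s = x.
Proof.
move=> eX; have [p injp] : embeds (T * X) by apply: embeds_prod => //; exists id.
have /choice[d dP] : forall t, exists x, forall y, t = p y -> y.2 = x.
  move=> t; have [[y ->]|noy] := pselect (exists y, t = p y).
    by exists y.2 => z /injp ->.
  by exists x0 => y ty; case: noy; exists y.
exists d => x t; have [|s lts] := @unbounded_injection (fun s => p (s, x)) t.
  by move=> a b /injp[].
by exists (p (s, x)) => //; rewrite -(dP _ _ erefl).
Qed.

End ShortWellorder.

End Continuum.

(** * The transfinite construction *)

Section Recursion.
Variables (A B : Type) (lt : A -> A -> Prop) (P : A -> (A -> B) -> B -> Prop).
Hypothesis wf_lt : well_founded lt.
Hypothesis P_local : forall t z z' b,
  (forall s, lt s t -> z s = z' s) -> P t z b -> P t z' b.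

(** Well-founded recursion sees only earlier values; [extend] fills the rest with [b0], which is
    harmless by [P_local]. *)
Lemma wf_choice (b0 : B) :
  exists x : A -> B, forall t, (exists b, P t x b) -> P t x (x t).
Proof.
pose extend t (g : forall s, lt s t -> B) s :=
  if pselect (lt s t) is left h then g s h else b0.
have pick t z : {b | (exists b, P t z b) -> P t z b}.
  by apply: cid; have [[b Pb]|nb] := pselect (exists b, P t z b);
    [exists b|exists b0].
pose step t g := projT1 (pick t (extend t g)).
pose x := Fix wf_lt (fun=> B) step; exists x => t [b Pb].
have xt : x t = step t (fun s _ => x s).
  rewrite /x Fix_eq // => s g g' gg'; congr step.
  by apply/functional_extensionality_dep => u; apply/funext => h.
have ext s : lt s t -> x s = extend t (fun s _ => x s) s.
  by move=> st; rewrite /extend; case: pselect.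
rewrite xt; apply: (P_local (z := extend t (fun s _ => x s))) => [s /ext ->//|].
rewrite /step; case: (pick _ _) => b' /= ; apply.
by exists b; apply: P_local Pb => s; exact: ext.
Qed.

End Recursion.

Section Combinations.
Local Open Scope ring_scope.
Variables (H : zmodType) (L : choiceType) (v : L -> H).

Definition combination (c : seq (int * L)) : H := \sum_(p <- c) v p.2 *~ p.1.

Definition spanned (A : L -> Prop) (h : H) :=
  exists2 c, (forall p, p \in c -> A p.2) & h = combination c.

Definition independent (A : L -> Prop) :=
  forall (s : seq L) (k : L -> int), uniq s -> (forall l, l \in s -> A l) ->
    \sum_(l <- s) v l *~ k l = 0 -> forall l, l \in s -> k l = 0.

Lemma spanned0 A : spanned A 0.
Proof. by exists [::] => //; rewrite /combination big_nil. Qed.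

Lemma spannedB A g h : spanned A g -> spanned A h -> spanned A (g - h).
Proof.
move=> [c Ac ->] [d Ad ->]; exists (c ++ [seq (- p.1, p.2) | p <- d]).
  by move=> p; rewrite mem_cat => /orP[/Ac //|/mapP[q /Ad Aq ->]].
rewrite /combination big_cat big_map /= -sumrN; congr (_ + _).
by apply: eq_bigr => p _; rewrite mulrNz.
Qed.

Lemma spanned_sum A (s : seq L) (k : L -> int) :
  (forall l, l \in s -> k l != 0 -> A l) ->
  spanned A (\sum_(l <- s) v l *~ k l).
Proof.
move=> As; exists [seq (k l, l) | l <- s & k l != 0].
  by move=> p /mapP[l]; rewrite mem_filter => /andP[kl ls] ->; exact: As.
rewrite /combination big_map big_filter /= [LHS](bigID (fun l => k l != 0)) /=.
by rewrite [X in _ + X]big1 ?addr0 // => l /negPn/eqP ->; rewrite mulr0z.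
Qed.

Lemma combination_collect c :
  combination c = \sum_(l <- undup (map snd c)) v l *~ (\sum_(p <- c | p.2 == l) p.1).
Proof.
under eq_bigr do rewrite mulrz_sumr.
rewrite (exchange_big_dep xpredT) //= /combination.
rewrite big_seq [RHS]big_seq; apply: eq_bigr => p pc.
rewrite big_mkcond (bigD1_seq p.2) ?undup_uniq ?mem_undup ?map_f //= eqxx.
by rewrite big1 ?addr0 // => l; rewrite eq_sym => /negbTE ->.
Qed.

(** After collecting repeated letters, independence kills each coefficient times [n], hence each
    coefficient. *)
Lemma independent_torsion_free A h (n : int) : independent A -> spanned A h ->
  n != 0 -> h *~ n = 0 -> h = 0.
Proof.
move=> indA [c Ac ->] n0; rewrite combination_collect mulrz_suml => sum0.
have k0 := indA (undup (map snd c)) (fun l => (\sum_(p <- c | p.2 == l) p.1) * n).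
rewrite big_seq big1 // => l lc; have /eqP : (\sum_(p <- c | p.2 == l) p.1) * n = 0.
  apply: k0 lc; first exact: undup_uniq.
    by move=> l'; rewrite mem_undup => /mapP[p /Ac Ap ->].
  by rewrite -[RHS]sum0; apply: eq_bigr => l' _; rewrite mulrzA.
by rewrite mulf_eq0 (negbTE n0) orbF => /eqP ->; rewrite mulr0z.
Qed.

End Combinations.

Section Construction.
Local Open Scope classical_set_scope.
Local Open Scope ring_scope.
Variable H : topologicalZmodType.
Hypothesis hausH : hausdorff_space H.
Hypothesis noconvH : ~ (exists u : nat -> H, nontrivial_convergent u).
Hypothesis ccH : forall m (f : nat -> 'I_m -> H), exists y, acc f y.
Variable x0 : H.
Hypothesis x0_free : forall n, (0 < n)%N -> x0 *+ n != 0.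

Notation T := (nat -> bool).
Variable lt : T -> T -> Prop.
Hypothesis lt_short : short_wellorder lt.

(* [Some (t, i)] names the [i]-th element chosen at stage [t], and [None] names
   [x0]; a stage consists of the number of elements chosen there together with
   their enumeration (with irrelevant values beyond that number). *)
Notation letter := (option (T * nat)).
Notation stages := (T -> nat * (nat -> H)).

Definition value (z : stages) (l : letter) : H :=
  if l is Some (s, i) then (z s).2 i else x0.

Definition chosen (z : stages) (A : T -> Prop) (l : letter) : Prop :=
  if l is Some (s, i) then A s /\ (i < (z s).1)%N else True.

Notation span z A := (spanned (value z) (chosen z A)).

Lemma chosen_eq (z z' : stages) (A : T -> Prop) : (forall s, A s -> z s = z' s) ->
  chosen z A = chosen z' A.
Proof.
move=> zz'; apply/funext => -[[s i]|] //=; apply/propext.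
by split=> -[As]; rewrite (zz' _ As).
Qed.

Lemma value_eq (z z' : stages) (A : T -> Prop) l : (forall s, A s -> z s = z' s) ->
  chosen z A l -> value z l = value z' l.
Proof. by move=> zz'; case: l => [[s i]|] //= [/zz' ->]. Qed.

Lemma combination_eq (z z' : stages) (A : T -> Prop) c :
  (forall s, A s -> z s = z' s) -> (forall p, p \in c -> chosen z A p.2) ->
  combination (value z) c = combination (value z') c.
Proof.
move=> zz' cA; rewrite /combination big_seq [RHS]big_seq.
by apply: eq_bigr => p /cA /(value_eq zz') ->.
Qed.

Lemma span_eq (z z' : stages) (A : T -> Prop) : (forall s, A s -> z s = z' s) ->
  span z A = span z' A.
Proof.
move=> zz'; apply/funext => h; apply/propext; split=> -[c cA ->].
  by exists c; rewrite -?(chosen_eq zz') // (combination_eq zz').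
by exists c; rewrite ?(chosen_eq zz') // -(combination_eq zz') // (chosen_eq zz').
Qed.

(** An element of the span is spelled out as a word over [A], each term taking exactly three
    letters, and [g b] is prefixed as one more letter. *)
Lemma span_small (z : stages) (A : T -> Prop) : small A ->
  forall (g : T -> nat) (h : T -> H), (forall b, span z A (h b)) ->
    ~ injective (fun b => (g b, h b)).
Proof.
move=> sA g h spanh inj_gh; apply: sA.
have /choice[c cP] : forall b, exists c, (forall p, p \in c -> chosen z A p.2) /\
    h b = combination (value z) c.
  by move=> b; have [c ? ?] := spanh b; exists c.
pose w3 (p : int * letter) : seq (nat + T) := [:: inl (pickle p.1);
  if p.2 is Some q then inr q.1 else inl 0%N; inl (if p.2 is Some q then q.2 else 0%N)].
have inj_w3 : injective (flatten \o map w3).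
  elim=> [|[k l] c' IH] [|[k' l'] d] //= [/(pcan_inj pickleK) -> e1 e2 /IH ->].
  by case: l l' e1 e2 => [[s i]|] [[s' i']|] //= [->] ->.
exists (fun b => inl (g b) :: (flatten \o map w3) (c b)); split.
  move=> a b [gab /inj_w3 cab]; apply: inj_gh => /=.
  by rewrite gab; have [_ ->] := cP a; have [_ ->] := cP b; rewrite cab.
move=> b t; rewrite inE /= => /flattenP[_ /mapP[[k l] lc ->]].
have [/(_ _ lc) + _] := cP b; rewrite !inE /=.
case: l lc => [[s i]|] _ /=; first by move=> [As _] /orP[/eqP[->]|/eqP].
by move=> _ /eqP.
Qed.

(** Tasks are formal combinations fixed before the recursion; their letters receive values as the
    stages are built. *)
Variable task : T -> nat * (nat -> nat -> seq (int * letter)).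

(** The default 0 for codes with letters not yet chosen keeps every task inside the span of the
    earlier stages. *)
Definition task_sequence z t n (i : 'I_(task t).1) : H :=
  let c := (task t).2 n i in
  if `[< forall p, p \in c -> chosen z (lt^~ t) p.2 >] then combination (value z) c
  else 0.

Definition good_stage t z (b : nat * (nat -> H)) :=
  exists y, [/\ free_over (span z (lt^~ t)) (fun i : 'I_b.1 => b.2 i),
    forall i, adjoin (span z (lt^~ t)) (fun i : 'I_b.1 => b.2 i) (y i) &
    acc (@task_sequence z t) y].

Lemma good_stage_local t (z z' : stages) b : (forall s, lt s t -> z s = z' s) ->
  good_stage t z b -> good_stage t z' b.
Proof.
move=> zz' [y [fr ad accy]]; exists y; rewrite -(span_eq zz'); split=> //.
rewrite (_ : @task_sequence z' t = @task_sequence z t) //.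
apply/funext => n; apply/funext => i; rewrite /task_sequence -(chosen_eq zz').
by case: asboolP => // cA; rewrite (combination_eq zz').
Qed.

Lemma good_stage_exists t z : independent (value z) (chosen z (lt^~ t)) ->
  exists b, good_stage t z b.
Proof.
move=> ind; have small_t : small (lt^~ t) by case: lt_short.
have [||||n i|s [x [y [fr ad accy]]]] := accumulation_free_extension hausH noconvH ccH
  (D := span z (lt^~ t)) _ _ _ _ (f := @task_sequence z t).
- exact: spanned0.
- exact: spannedB.
- by move=> a k; exact: independent_torsion_free.
- exact: span_small.
- rewrite /task_sequence; case: asboolP => [cA|_]; last exact: spanned0.
  by exists ((task t).2 n i).
exists (s, fun j => if insub j is Some i then x i else 0); exists y.
rewrite (_ : (fun i : 'I__ => _) = x) //.
by apply/funext => i /=; rewrite valK.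
Qed.

Lemma stage_max (S : seq T) s0 : s0 \in S ->
  exists2 s, s \in S & forall t, t \in S -> t = s \/ lt t s.
Proof.
have [_ trans total _] := lt_short.
elim: S s0 => // a [|b S] IH s0 _.
  by exists a; rewrite ?inE // => t; rewrite inE => /eqP; left.
have [|s sS max_s] := IH b; first by rewrite inE eqxx.
have [sa|sa|as_] := total s a.
- exists a; rewrite ?inE ?eqxx // => t; rewrite inE => /orP[/eqP|/max_s]; first by left.
  by move=> [->|ts]; right=> //; exact: trans sa.
- exists s; first by rewrite inE sS orbT.
  by move=> t; rewrite inE => /orP[/eqP ->|/max_s //]; left.
exists s; first by rewrite inE sS orbT.
by move=> t; rewrite inE => /orP[/eqP ->|/max_s //]; right.
Qed.

(* The part of a relation that belongs to its last stage [s] lies in the span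
   of the earlier ones, over which the elements of stage [s] are free. *)
Lemma independent_stages (z : stages) (A : T -> Prop) :
  (forall s, A s ->
    free_over (span z (lt^~ s)) (fun i : 'I_(z s).1 => (z s).2 i)) ->
  independent (value z) (chosen z A).
Proof.
move=> fr ls k uls lsA sum0 l0 l0s; apply/eqP/negPn/negP => kl0.
pose live l := (l \in ls) && (k l != 0).
pose stage_of (l : letter) := if l is Some p then [:: p.1] else [::].
pose S := flatten [seq stage_of l | l <- ls & k l != 0].
have inS s i : live (Some (s, i)) -> s \in S.
  move=> /andP[lls kl]; apply/flattenP; exists [:: s]; last by rewrite inE.
  by apply/mapP; exists (Some (s, i)) => //; rewrite mem_filter kl.
(* With no stage involved, the relation is a nonzero multiple of [x0], which has infinite order. *)
have [noS|[s1 s1S]] : (S = [::]) \/ exists s, s \in S.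
    case: (S) => [|s S']; first by left.
    by right; exists s; rewrite inE eqxx.
  have live0 l : live l -> l = None.
    by case: l => // -[s i] /inS; rewrite noS.
  have l0N : l0 = None by apply: live0; rewrite /live l0s.
  have : x0 *~ k None = 0.
    rewrite -[RHS]sum0 (bigD1_seq None) -?l0N //= big1_seq ?addr0 ?l0N //.
    move=> l /andP[lN lls]; have [->|kl] := eqVneq (k l) 0; first by rewrite mulr0z.
    by case/eqP: lN; apply: live0; rewrite /live lls.
  rewrite l0N in kl0; case: (k None) kl0 => n n0.
    by apply/eqP/x0_free; rewrite lt0n.
  by move/eqP; rewrite NegzE mulrNz oppr_eq0; apply/negP/x0_free.
have [s sS max_s] := stage_max s1S.
have [i0 live_s] : exists i, live (Some (s, i)).
  move: sS => /flattenP[_ /mapP[[[s' i]|] + ->]] //.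
  by rewrite mem_filter inE => /andP[kl lls] /eqP ->; exists i; apply/andP.
have /andP[i0ls ki0] := live_s; have [As i0s] := lsA _ i0ls.
pose at_s (l : letter) := if l is Some p then p.1 == s else false.
pose k' (i : 'I_(z s).1) := if Some (s, val i) \in ls then k (Some (s, val i)) else 0.
have sum_s : \sum_(i < (z s).1) (z s).2 i *~ k' i = \sum_(l <- ls | at_s l) value z l *~ k l.
  rewrite -[RHS]big_filter (perm_big [seq Some (s, val i) | i <- enum 'I_(z s).1 &
    Some (s, val i) \in ls]); last first.
    apply: uniq_perm => [||l].
    - by rewrite filter_uniq.
    - rewrite map_inj_uniq; first by rewrite filter_uniq ?enum_uniq.
      by move=> i j [] /val_inj.
    rewrite mem_filter; apply/andP/mapP => [[]|[i]]; last first.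
      by rewrite mem_filter => /andP[lls _] ->; rewrite /= eqxx.
    case: l => //= -[s' i] /= /eqP -> lls.
    have [_ /= iz] := lsA _ lls.
    by exists (Ordinal iz) => //; rewrite mem_filter mem_enum /= lls.
  rewrite big_map big_filter big_enum_cond /= [RHS]big_mkcond /=.
  by apply: eq_bigr => i _; rewrite /k'; case: ifP => // _; rewrite mulr0z.
have /fr : A s by [].
move=> /(_ k' _ (Ordinal i0s)); rewrite /k' /=.
rewrite i0ls => kz; move: ki0; rewrite kz ?eqxx //.
rewrite sum_s; have := sum0; rewrite (bigID at_s) /= => /eqP.
rewrite addr_eq0 => /eqP ->; rewrite -sub0r; apply: spannedB.
  exact: spanned0.
rewrite -big_filter; apply: spanned_sum => l; rewrite mem_filter => /andP[nat_s lls] kl.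
have := lsA l lls; case: l nat_s lls kl => // -[t i] /= ts lls kl [At iz].
split=> //; have [|te|//] := max_s t; first by apply: (inS _ i); apply/andP.
by rewrite te eqxx in ts.
Qed.

(** By induction, earlier good stages are independent, so a good choice exists at [t] and the
    recursion has made one. *)
Lemma good_stages_exist : exists x : stages, forall t, good_stage t x (x t).
Proof.
have [wf_lt _ _ _] := lt_short.
have [x xP] := wf_choice wf_lt good_stage_local (0%N, fun=> 0).
exists x; elim/(well_founded_ind wf_lt) => t IH.
apply/xP/good_stage_exists/independent_stages => s /IH [y []].
by [].
Qed.

End Construction.

(** * Free groups with an induced topology *)

Section FreeLift.
Local Open Scope ring_scope.
Variables (H : zmodType) (I : choiceType) (v : I -> H).

Definition free_lift (g : {freeg I}) : H := fglift (v : I -> zmodule H) g.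

Lemma free_lift_is_additive : zmod_morphism free_lift.
Proof. exact: (lift_is_additive (v : I -> zmodule H)). Qed.

HB.instance Definition _ :=
  GRing.isZmodMorphism.Build {freeg I} H free_lift free_lift_is_additive.

Lemma free_liftU k i : free_lift << k *g i >> = v i *~ k.
Proof. exact: (liftU (v : I -> zmodule H)). Qed.

Lemma free_liftE g : free_lift g = \sum_(i <- dom g) v i *~ coeff i g.
Proof.
rewrite -[in LHS](freeg_sumE g) raddf_sum.
by apply: eq_bigr => i _; rewrite -free_liftU.
Qed.

End FreeLift.

Section Pullback.
Local Open Scope classical_set_scope.
Local Open Scope ring_scope.
Variables (V : zmodType) (H : topologicalZmodType) (phi : {additive V -> H}).

(** Keeping [phi] as a parameter of the type lets the topology instance depend on it. *)
Definition pullback : Type := let _ := phi in V.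

HB.instance Definition _ := GRing.Zmodule.copy pullback V.
HB.instance Definition _ := Topological.copy pullback (initial_topology phi).

Lemma nbhs_pullback (g : pullback) (U : set pullback) :
  nbhs g U <-> exists2 A, nbhs (phi g) A & phi @^-1` A `<=` U.
Proof.
split=> [[_ [[B Bop <-] Bg] sub]|[A nA sub]].
  by exists B => //; exact: open_nbhs_nbhs.
apply: (filterS sub); exact: (@initial_continuous _ _ phi g).
Qed.

Lemma pullback_sub_continuous : continuous (fun p : pullback * pullback => p.1 - p.2).
Proof.
move=> [g h] U /nbhs_pullback[A nA sub].
have [[B C] /= [nB nC] subBC] : nbhs (phi g, phi h) [set q : H * H | A (q.1 - q.2)].
  by apply: sub_continuous; rewrite /= -raddfB.
exists (phi @^-1` B, phi @^-1` C) => /=.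
  by split; apply/nbhs_pullback; [exists B|exists C].
move=> [a b] [/= Ba Cb]; apply: sub => /=; rewrite raddfB.
exact: (subBC (phi a, phi b)).
Qed.

HB.instance Definition _ :=
  PreTopologicalNmodule_isTopologicalZmodule.Build pullback pullback_sub_continuous.

Hypothesis hausH : hausdorff_space H.
Hypothesis noconvH : ~ (exists u : nat -> H, nontrivial_convergent u).
Hypothesis inj_phi : injective phi.

Lemma nbhs0_pullback (U : set pullback) :
  nbhs (0 : pullback) U <-> exists2 A, nbhs (0 : H) A & phi @^-1` A `<=` U.
Proof. by rewrite -[0 : H](raddf0 phi); exact: nbhs_pullback. Qed.

Lemma pullback_hausdorff : hausdorff_space pullback.
Proof.
move=> g h clgh; apply: inj_phi; apply/eqP; rewrite -subr_eq0; apply/eqP.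
apply: (hausdorff_nbhs0 hausH) => U nU; have [V' nV' subV] := nbhs0_sub nU.
have nb (k : pullback) : nbhs k (phi @^-1` [set a | V' (a - phi k)]).
  apply/nbhs_pullback; exists [set a | V' (a - phi k)] => //.
  by apply/nbhs0_translate; apply: filterS nV' => a /=; rewrite addrK.
have [k [/= kg kh]] := clgh _ _ (nb g) (nb h).
by have := subV _ _ kh kg; rewrite opprB addrC addrA addrNK.
Qed.

Lemma pullback_no_convergent : ~ (exists u : nat -> pullback, nontrivial_convergent u).
Proof.
move=> [u [[l ul] nc]]; apply: noconvH; exists (phi \o u); split.
  exists (phi l) => A nA; apply: (ul (phi @^-1` A)).
  by apply/nbhs_pullback; exists A.
move=> [c [N _ cst]]; apply: nc; exists (u N); exists N => // n Nn /=.
by apply: inj_phi; rewrite -[RHS]/((phi \o u) N) (cst N) /= ?leqnn // -(cst n).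
Qed.

Lemma pullback_acc m (f : nat -> 'I_m -> pullback) (y : 'I_m -> pullback) :
  acc (fun n i => phi (f n i)) (fun i => phi (y i)) -> acc f y.
Proof.
move=> accf U /nbhs0_pullback[A nA sub].
apply: frequently_sub (accf A nA) => n An i; apply: sub => /=.
by rewrite raddfB.
Qed.

End Pullback.

(** * The countable power is not countably compact *)

Section CountablePower.
Local Open Scope classical_set_scope.
Local Open Scope ring_scope.

(** The growing factors keep [y j] bounded by [B] and then force it to vanish for large [j], where
    the equation reads [0 = 1]. *)
Lemma no_integer_solution (y : nat -> int) :
  (forall j, y j = 1 + y j.+1 *+ j.+2) -> False.
Proof.
move=> yE; pose B := (absz (y 0%N)).+1.
have bnd j : (absz (y j) <= B)%N.
  elim: j => [|j IH]; first exact: leqnSn.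
  have := yE j; rewrite -mulr_natr => e; nia.
have z j : (B <= j)%N -> y j.+1 = 0.
  move=> Bj; have := yE j; have := bnd j; rewrite -mulr_natr => b e; nia.
by have := yE B.+1; rewrite !z // mul0rn addr0.
Qed.

(* The coordinates of an accumulation point of [n |-> (partial j (n - j))_j]
   satisfy [y_j = a + (j + 2) y_(j+1)], which has no solution in [Z] for [a = 1]. *)
Fixpoint partial (G : zmodType) (a : G) d j : G :=
  if d is e.+1 then a + partial a e j.+1 *+ j.+2 else 0.

Lemma partialS (G : zmodType) (a : G) d j :
  partial a d.+1 j = a + partial a d j.+1 *+ j.+2.
Proof. by []. Qed.

Lemma power_nat_not_countably_compact (G : topologicalZmodType) (c : {additive G -> int}) :
  hausdorff_space G -> (exists a, c a = 1) -> ~ countably_compact {ptws nat -> G}.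
Proof.
move=> hG [a ca] ccG.
(* For [n > j], coordinates [j] and [j.+1] of the [n]-th term are linked by one step of [partial];
   the link passes to [y] by continuity. *)
have [y accy] := ccG (fun n j => partial a (n - j)%N j).
apply: (@no_integer_solution (fun j => c (y j))) => j.
suff -> : y j = a + y j.+1 *+ j.+2 by rewrite raddfD raddfMn /= ca.
apply/eqP; rewrite -subr_eq0; apply/eqP; apply: (hausdorff_nbhs0 hG) => U nU.
have [V nV subV] := nbhs0_sub nU; have [W nW mulW] := nbhs0_mulrz j.+2 nV.
have near_y i (A : set G) : nbhs (0 : G) A ->
    nbhs y [set g : nat -> G | A (g i - y i)].
  move=> nA; apply: (@nbhs_ptws_proj G _ y i [set h | A (h - y i)]).
  by apply/nbhs0_translate; apply: filterS nA => h /=; rewrite addrK.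
have fr := (infinite_frequently _).1
  (accy _ (filterI (near_y j _ nV) (near_y j.+1 _ nW))).
have [n [lt_jn [/= Vn Wn]]] := fr (nbhs_filter y) j.+1.
have := subV _ _ (mulW _ Wn) Vn; congr U.
rewrite -(subnSK lt_jn) partialS mulrzBl !pmulrn.
move: (_ *~ _) (_ *~ _) => p q.
by rewrite opprB [LHS]addrC !opprD !addrA addrNK.
Qed.

End CountablePower.

(** * The group *)

Section CardinalityLowerBound.
Local Open Scope classical_set_scope.
Local Open Scope ring_scope.

(** The multiples of [a] form a sequence to which [perfect_accumulation] applies: [c] shows that
    their nonzero multiples are pairwise distinct. *)
Lemma continuum_le_group (G : topologicalZmodType) (c : {additive G -> int}) :
  hausdorff_space G -> ~ (exists u : nat -> G, nontrivial_convergent u) ->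
  (forall m (f : nat -> 'I_m -> G), exists y, acc f y) ->
  (exists a, c a = 1) -> exists f : (nat -> bool) -> G, injective f.
Proof.
move=> hG ncG ccG [a ca].
have [k [i ki] g|y [_ inj_y]] :=
    perfect_accumulation hG ncG ccG (f := fun n (_ : 'I_1) => a *+ n).
  move=> fr; have [p [_ ep]] := fr 0%N; have [q [pq eq]] := fr p.+1.
  have /(congr1 c) : \sum_(i < 1) a *+ p *~ k i = \sum_(i < 1) a *+ q *~ k i.
    by rewrite ep eq.
  rewrite !big_ord1 !raddfMz !raddfMn /= ca !mulrzz !natz.
  rewrite (ord1 i) in ki.
  by move=> /(mulIf ki) [epq]; rewrite epq ltnn in pq.
exists (fun b => \sum_i y b i *~ 1); apply: (inj_y (fun=> 1)).
by exists ord0.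
Qed.

End CardinalityLowerBound.

Lemma injective_card_le (A B : Type) (f : A -> B) : injective f ->
  ([set: A] #<= [set: B])%card.
Proof.
move=> injf; have /injfunPex[h] : exists2 g : A -> B,
    set_fun [set: A] [set: B] g & set_inj [set: A] g.
  by exists f => // a b _ _; exact: injf.
exact: inj_card_le.
Qed.

Section Assembly.
Local Open Scope classical_set_scope.
Local Open Scope ring_scope.
Variable H : topologicalZmodType.
Hypothesis hausH : hausdorff_space H.
Hypothesis noconvH : ~ (exists u : nat -> H, nontrivial_convergent u).
Hypothesis ccH : forall m (f : nat -> 'I_m -> H), exists y, acc f y.
Variable x0 : H.
Hypothesis x0_free : forall n, (0 < n)%N -> x0 *+ n != 0.

Notation T := (nat -> bool).
Notation letter := (option (T * nat)).

Lemma embeds_codes : embeds (seq (int * letter)).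
Proof.
apply: embeds_seq; apply: embeds_prod; first exact: embeds_count.
apply: (@embeds_inj _ (bool * (T * nat))
  (fun l => if l is Some p then (true, p) else (false, (fun=> true, 0%N)))).
  by move=> [p|] [q|] //= [->].
apply: embeds_prod; first exact: embeds_count.
by apply: embeds_prod; [exists id|exact: embeds_count].
Qed.

Lemma free_group_exists : exists (I : choiceType) (phi : {additive {freeg I} -> H}),
  [/\ injective phi, inhabited I, embeds {freeg I} &
    forall m (f : nat -> 'I_m -> {freeg I}),
      exists y : 'I_m -> {freeg I}, acc (fun n i => phi (f n i)) (fun i => phi (y i))].
Proof.
have [lt lt_short] := continuum_wellorder.
have embeds_task : embeds (nat * (nat -> nat -> seq (int * letter))).
  by apply: embeds_prod; [exact: embeds_count|do 2 apply: embeds_fun; exact: embeds_codes].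
(* Every task recurs at arbitrarily late stages. *)
have [task taskP] := unbounded_enumeration lt_short (0%N, fun _ _ => [::]) embeds_task.
have [x xP] := good_stages_exist hausH noconvH ccH x0_free lt_short task.
pose everywhere (_ : T) := True.
have ind : independent (value x0 x) (chosen x everywhere).
  by apply: (independent_stages x0_free lt_short) => s _; have [y []] := xP s.
pose I : choiceType := {l : letter | `[< chosen x everywhere l >]}.
have IP (i : I) : chosen x everywhere (val i) by apply/asboolP/(valP i).
pose phi : {additive {freeg I} -> H} := free_lift (fun i : I => value x0 x (val i)).
have phiE g : phi g = \sum_(i <- dom g) value x0 x (val i) *~ coeff i g.
  exact: free_liftE.
pose code (g : {freeg I}) : seq (int * letter) := [seq (coeff i g, val i) | i <- dom g].
have codeE g : combination (value x0 x) (code g) = phi g.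
  by rewrite phiE /combination /code big_map.
have phi_onto h : spanned (value x0 x) (chosen x everywhere) h -> exists g, phi g = h.
  move=> [c cI ->]; elim: c cI => [|[k l] c IHc] cI.
    by exists 0; rewrite raddf0 /combination big_nil.
  have [|g gP] := IHc; first by move=> p pc; apply: cI; rewrite inE pc orbT.
  have lI : `[< chosen x everywhere l >].
    by apply/asboolP/(cI (k, l)); rewrite inE eqxx.
  exists (<< k *g exist _ l lI : I >> + g).
  by rewrite raddfD /= gP /combination big_cons /= free_liftU.
have inj_phi : injective phi.
  apply: raddf_inj => g; rewrite phiE => sum0; apply/eqP.
  rewrite -dom_eq0; case dg: (dom g) => [|i s] //.
  pose k (l : letter) := if insub l is Some i then coeff (i : I) g else 0.
  have kE (j : I) : k (val j) = coeff j g by rewrite /k valK.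
  have kz l : l \in map val (dom g) -> k l = 0.
    apply: ind; first by rewrite map_inj_uniq ?uniq_dom //; exact: val_inj.
      by move=> l' /mapP[j _ ->]; exact: IP.
    by rewrite big_map -[RHS]sum0; apply: eq_bigr => j _; rewrite kE.
  have ig : i \in dom g by rewrite dg inE eqxx.
  have := kz (val i) (map_f _ ig); rewrite kE => /eqP.
  by move: ig; rewrite mem_dom => /negbTE ->.
exists I, phi; split=> //.
- have cN : `[< chosen x everywhere None >] by apply/asboolP.
  by constructor; exists None.
- apply: (embeds_inj (f := code)) embeds_codes => g h gh.
  by apply: inj_phi; rewrite -!codeE gh.
move=> m f.
(* [u] lists the stages occurring in the codes of all [f n i], indexed by [n], [i] and the position.
   A stage [t] beyond them all knows the whole sequence. *)
pose u N := if (unpickle N : option (nat * 'I_m * nat)) is Some (n, i, r) then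
  if nth (0, None) (code (f n i)) r is (_, Some (s, _)) then s else fun=> true
  else fun=> true.
have [t0 t0P] := countable_bounded lt_short u.
pose enc n j := if insub j is Some i then code (f n i) else [::].
have [t t0t dt] := taskP (m, enc) t0.
have before n i p : p \in code (f n i) -> chosen x (lt^~ t) p.2.
  move=> pc; have /mapP[j _ pE] := pc; have := IP j.
  have <- : p.2 = val j by rewrite pE.
  case vp: p => [z [[s q]|]] //= [_ qx]; split=> //.
  have [_ trans _ _] := lt_short; apply: trans t0t.
  have := t0P (pickle (n, i, index p (code (f n i)))).
  by rewrite /u pickleK nth_index // vp.
have encE n (i : 'I_m) : enc n i = code (f n i) by rewrite /enc valK.
have [y ad accy] : exists2 y : 'I_m -> H,
    forall i, spanned (value x0 x) (chosen x everywhere) (y i) &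
    acc (fun n i => phi (f n i)) y.
  (* Generalizing over [q] allows rewriting with [dt] although the index type depends on the
     task. *)
  have transport q : q = (m, enc) -> (exists2 y : 'I_q.1 -> H,
      forall i, spanned (value x0 x) (chosen x everywhere) (y i) &
      acc (fun n i => let c := q.2 n (i : nat) in
        if `[< forall p, p \in c -> chosen x (lt^~ t) p.2 >]
        then combination (value x0 x) c else 0) y) ->
      exists2 y : 'I_m -> H,
        forall i, spanned (value x0 x) (chosen x everywhere) (y i) &
        acc (fun n i => phi (f n i)) y.
    move=> -> [y yspan accy]; exists y => // U nU.
    apply: frequently_sub (accy U nU) => n Un i; have := Un i.
    rewrite /= encE codeE ifT //; apply/asboolP; exact: before.
  apply: (transport _ dt).
  have [y [_ ad accy]] := xP t; exists y => // i.
  have [k [c cP yE]] := ad i.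
  (* The part over the earlier stages is followed by the new letters of stage [t]. *)
  exists (c ++ [seq (k j, Some (t, val j)) | j <- enum 'I_(x t).1]).
    move=> p; rewrite mem_cat => /orP[/cP|/mapP[j _ ->]]; last by split; rewrite ?ltn_ord.
    by case: p => z [[s r]|] //= [].
  move/eqP: yE; rewrite subr_eq => /eqP ->.
  by rewrite /combination big_cat big_map big_enum.
have /choice[g gP] : forall i, exists h, phi h = y i by move=> i; exact: phi_onto.
by exists g; rewrite (_ : (fun i => phi (g i)) = y) //; apply/funext.
Qed.

End Assembly.

Theorem theorem8 :
  (exists H : topologicalZmodType,
    [/\ hausdorff_space H,
        non_torsion H,
        ~ (exists u : nat -> H, nontrivial_convergent u) &
        forall m : nat, countably_compact {ptws 'I_m -> H}]) ->
  exists G : topologicalZmodType,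
    [/\ hausdorff_space G,
        free_abelian G,
        has_card_continuum G,
        forall m : nat, countably_compact {ptws 'I_m -> G} &
        ~ countably_compact {ptws nat -> G}].
Proof.
move=> [H [hausH [x0 x0_free] noconvH ccH]].
have accH m (f : nat -> 'I_m -> H) : exists y, acc f y.
  by have [y /accumulation_acc accy] := ccH m f; exists y.
have [I [phi [inj_phi [i0] embI acc_phi]]] :=
  free_group_exists hausH noconvH accH x0_free.
pose G : topologicalZmodType := pullback phi.
have hausG : hausdorff_space G by exact: pullback_hausdorff hausH inj_phi.
have noconvG : ~ (exists u : nat -> G, nontrivial_convergent u).
  exact: pullback_no_convergent noconvH inj_phi.
have accG m (f : nat -> 'I_m -> G) : exists y, acc f y.
  by have [y /(pullback_acc (f := f)) accy] := acc_phi m f; exists y.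
(* The coordinate at a basis element maps that element to 1. *)
pose c : {additive G -> int} := coeff i0.
have c1 : exists a : G, c a = 1%R by exists << i0 >>; rewrite /c /= coeffU eqxx mulr1.
exists G; split=> //.
- by exists I, idfun; exists idfun.
(* Codes bound the cardinality above and a perfect set of accumulation points bounds it below;
   Cantor-Bernstein concludes. *)
- have [f injf] := continuum_le_group hausG noconvG accG c1; have [g injg] := embI.
  rewrite /has_card_continuum card_eq_le; apply/andP.
  by split; [exact: injective_card_le injg|exact: injective_card_le injf].
- move=> m f; have [y accy] := accG m f; exists y.
  exact/accumulation_acc.
exact: power_nat_not_countably_compact hausG c1.
Qed.
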